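(* Let $\Gamma$ be a discrete group. Then $\Gamma$ has an essentially free amenable almost-action (on some set $X$ with some finitely additive probability measure $\mu$) if and only if $\Gamma$ is sofic.
   Context: For $n\ge1$, $S_n$ is the symmetric group on $n$ elements and $\#_{\rm fix}\pi$ is the number of fixed points of $\pi\in S_n$. A group $\Gamma$ is sofic if for every real $0<\varepsilon<1$ and every finite subset $F\subseteq\Gamma$ there exist a natural number $n\ge 1$ and a function $\phi:\Gamma\to S_n$ such that (a) $\#_{\rm fix}(\phi(e)\phi(f)\phi(ef)^{-1})\ge(1-\varepsilon)n$ for all $e,f\in F$; (b) $\phi(1)=1$; (c) $\#_{\rm fix}\phi(e)\le\varepsilon n$ for every $1\ne e\in F$. Let $X$ be a set, $\mu$ a finitely additive probability measure defined on all subsets of $X$, and for each $g\in\Gamma$ let $\phi(g):X\to X$ be a bijection. $(\Gamma,X,\mu,\phi)$ is an amenable almost-action if: (i) $\phi(1)$ is the identity transformation of $X$; (ii) $\mu(\phi(g)(L))=\mu(L)$ for all $g\in\Gamma$, $L\subseteq X$; (iii) for any $g,h\in\Gamma$ there exists a subset $A_{g,h}\subseteq X$ with $\mu(A_{g,h})=1$ such that $\phi(gh)(x)=\phi(g)(\phi(h)(x))$ for all $x\in A_{g,h}$. It is essentially free if the fixed point set of $\phi(g)$ has $\mu$-measure $0$ for all $1\neq g\in\Gamma$. *)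

(* Defs.v *)
From mathcomp Require Import all_boot all_order all_fingroup all_algebra.
From mathcomp Require Import boolp classical_sets functions cardinality reals.

Set Implicit Arguments.
Unset Strict Implicit.
Unset Printing Implicit Defensive.

Import Order.TTheory GRing.Theory Num.Theory.

Local Open Scope classical_set_scope.
Local Open Scope ring_scope.

Definition nb_fix (n : nat) (s : 'S_n) : nat := #|[set i : 'I_n | s i == i]%SET|.

(* Permutations act on the left in the definition of soficity, whereas MathComp
   has (s * t)%g i = t (s i): the composite phi(e) phi(f) phi(ef)^-1, which
   applies phi(ef)^-1 first, is therefore written in reverse order. *)
Definition sofic (R : realType) (Gamma : groupType) : Prop :=
  forall (eps : R) (F : set Gamma), 0 < eps < 1 -> finite_set F ->
  exists (n : nat) (phi : Gamma -> 'S_n),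
    [/\ (1 <= n)%N,
        forall e f : Gamma, F e -> F f ->
          (1 - eps) * n%:R <=
            (nb_fix ((phi (e * f)%g)^-1 * phi f * phi e)%g)%:R,
        phi 1%g = 1%g &
        forall e : Gamma, F e -> e <> 1%g -> (nb_fix (phi e))%:R <= eps * n%:R].

(* MathComp-Analysis contents live on a type equipped with a (semi)ring of sets
   and take values in the extended reals; here X is a bare type, all of its
   subsets are measured and the values are real. *)
Record finadd_probability (R : realType) (X : Type) (mu : set X -> R) : Prop :=
  FinaddProbability {
    finadd_ge0 : forall A : set X, 0 <= mu A;
    finadd_setT : mu setT = 1;
    finadd_setU : forall A B : set X,
      A `&` B = set0 -> mu (A `|` B) = mu A + mu B }.

Record amenable_almost_action (R : realType) (Gamma : groupType) (X : Type)
    (mu : set X -> R) (phi : Gamma -> X -> X) : Prop :=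
  AmenableAlmostAction {
    almost_action_prob : finadd_probability mu;
    almost_action_bij : forall g : Gamma, bijective (phi g);
    almost_action1 : forall x : X, phi 1%g x = x;
    almost_action_invariant : forall (g : Gamma) (L : set X),
      mu (phi g @` L) = mu L;
    almost_actionM : forall g h : Gamma, exists A : set X,
      mu A = 1 /\ forall x : X, A x -> phi (g * h)%g x = phi g (phi h x) }.

Definition essentially_free (R : realType) (Gamma : groupType) (X : Type)
    (mu : set X -> R) (phi : Gamma -> X -> X) : Prop :=
  forall g : Gamma, g <> 1%g -> mu [set x | phi g x = x] = 0.

(* Main.v *)
Require Import Defs.
From mathcomp Require Import all_boot all_order all_fingroup all_algebra.
From mathcomp Require Import finmap.
From mathcomp Require Import boolp classical_sets functions cardinality reals.
From mathcomp Require Import zify lra.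
From mathcomp Require Import filter topology normedtype.

(* From an almost-action to soficity: fix a finite part of Gamma and let B be
   the mu-null set of points where the relations or freeness fail on it.  If
   every finite S off B were expanded by a factor (q + 1) / q, Hall's marriage
   theorem would inject q + 1 copies of X \ B into q copies of X piecewise by
   the transformations phi g, which preserve mu: a contradiction.  So there is a
   finite S off B that is almost invariant, and the partial injections induced
   by the phi g on S extend to permutations of S.

   Conversely, the disjoint union of the finite sets on which sofic
   approximations act, with the ultralimit of the normalized counting measures,
   carries an essentially free almost-action. *)

Set Implicit Arguments.
Unset Strict Implicit.
Unset Printing Implicit Defensive.

Import Order.TTheory GRing.Theory Num.Theory.
Import numFieldNormedType.Exports.

(** * Hall's marriage theorem for infinite families of finite sets *)

Section Hall.
Local Open Scope fset_scope.
Local Open Scope nat_scope.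
Variables I V : choiceType.
Implicit Types (A : I -> {fset V}) (J K : {fset I}).

Definition hall A :=
  forall J : {fset I}, #|` J| <= #|` \bigcup_(i <- J) A i|.

Definition drop_at A (i : I) (x : V) (j : I) : {fset V} :=
  if j == i then A i `\ x else A j.

(** A finite set violating Hall's condition after the removal must contain [i], since [drop_at]
    changes no other member; [K] is that set without [i]. *)
Lemma not_hall_drop_at A i x : hall A -> ~ hall (drop_at A i x) ->
  exists K, #|` (A i `\ x) `|` \bigcup_(j <- K) A j| <= #|` K|
            /\ i \notin K.
Proof.
move=> hA /existsNP[J /negP]; rewrite -ltnNge => ltJ.
have dropE K : i \notin K ->
    \bigcup_(j <- K) drop_at A i x j = \bigcup_(j <- K) A j.
  move=> iK; apply: eq_big_seq => j jK; rewrite /drop_at.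
  by case: eqP => // eji; rewrite -eji jK in iK.
have [iJ|iJ] := boolP (i \in J); last first.
  by move: ltJ; rewrite dropE // ltnNge hA.
exists (J `\ i); split; last by rewrite !inE eqxx.
have iJi : i \notin J `\ i by rewrite !inE eqxx.
rewrite -ltnS -[X in _ < X]add1n -[1]/(nat_of_bool true) -iJ -cardfsD1.
apply: leq_ltn_trans ltJ; apply: fsubset_leq_card.
apply/fsubUsetP; split.
  have := bigfcup_sup (drop_at A i x) iJ isT.
  by rewrite {1}/drop_at eqxx.
apply/bigfcupsP => j jJ _; move: jJ; rewrite !inE => /andP[ji jJ].
by have := bigfcup_sup (drop_at A i x) jJ isT; rewrite {1}/drop_at (negPf ji).
Qed.

(** Submodularity: suppose both removals fail, with witnesses [K], [L] and unions [U], [W]. As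
    [x != y], the union of [U] and [W] covers the members over [K], [L] and [i]; their intersection
    covers those over the intersection of [K] and [L]. Hall's condition then gives |K| + |L| + 1 <=
    |U| + |W|, whereas |U| <= |K| and |W| <= |L|. *)
Lemma hall_drop_at A i x y : hall A -> x != y ->
  x \in A i -> y \in A i -> hall (drop_at A i x) \/ hall (drop_at A i y).
Proof.
move=> hA xy xA yA; apply: contrapT => /not_orP[].
move=> /(not_hall_drop_at hA)[K [leK iK]] /(not_hall_drop_at hA)[L [leL iL]].
set U := (A i `\ x) `|` _ in leK; set W := (A i `\ y) `|` _ in leL.
have := hA (i |` (K `|` L)); rewrite cardfsU1 !inE negb_or iK iL /=.
have := hA (K `&` L).
have sup1 : \bigcup_(j <- i |` (K `|` L)) A j `<=` U `|` W.
  apply/bigfcupsP => j; rewrite !inE => jKL _; apply/fsubsetP => v vA.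
  case/orP: jKL => [/eqP eji|/orP[jK|jL]].
  - subst j; rewrite !inE vA !andbT; have [->|//] := eqVneq v x.
    by rewrite xy /= orbT.
  - rewrite !inE; apply/orP; left; apply/orP; right.
    by apply/bigfcupP; exists j; rewrite ?jK.
  - rewrite !inE; apply/orP; right; apply/orP; right.
    by apply/bigfcupP; exists j; rewrite ?jL.
have sup2 : \bigcup_(j <- K `&` L) A j `<=` U `&` W.
  apply/bigfcupsP => j; rewrite !inE => /andP[jK jL] _; apply/fsubsetP => v vA.
  by rewrite !inE; apply/andP; split; apply/orP; right; apply/bigfcupP;
    exists j; rewrite ?jK ?jL.
have := fsubset_leq_card sup1; have := fsubset_leq_card sup2.
have := cardfsUI U W; have := cardfsUI K L.
lia.
Qed.

(* Rado's proof: by Zorn's lemma a family satisfying Hall's condition shrinks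
   to a minimal one, whose members are singletons by [hall_drop_at]. *)
Lemma hall_matching A : hall A ->
  exists m : I -> V, injective m /\ forall i, m i \in A i.
Proof.
move=> hA.
(* [D] records deleted pairs, so a maximal [D] is a minimal family. *)
pose sub (D : set (I * V)) i := [fset v in A i | ~~ `[< D (i, v) >]].
have inS D i v : reflect (v \in A i /\ ~ D (i, v)) (v \in sub D i).
  by rewrite !inE; apply: (iffP andP) => -[? /asboolPn].
have [|D [hD maxD]] := @Zorn_bigcup (I * V)%type [set D | hall (sub D)]%classic.
  move=> F FP Ftot J /=; set D := (\bigcup_(X in F) X)%classic.
  have [[D' D'F]|F0] := pselect (exists D', F D'); last first.
    suff -> : sub D = A by exact: hA.
    apply/funext => i; apply/fsetP => v; apply/inS/idP => [[]//|vA].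
    by split=> // -[D' D'F]; case: F0; exists D'.
  (* Only finitely many pairs concern [J], so a single member [E] of the chain already contains all
     those that the union deletes. *)
  have [E [EF DE]] : exists E, F E /\ forall i v, i \in J -> v \in A i ->
       D (i, v) -> E (i, v).
    pose s := [seq (i, v) | i <- enum_fset J, v <- enum_fset (A i)].
    suff [E [EF sE]] : exists E, F E /\ forall p, p \in s -> D p -> E p.
      exists E; split=> // i v iJ vA; apply: sE.
      by apply/allpairsPdep; exists i, v.
    elim: s => [|p s [E [EF sE]]]; first by exists D'.
    have [[E' E'F E'p]|nDp] := pselect (D p); last first.
      by exists E; split=> // q; rewrite inE => /orP[/eqP->|/sE//].
    have [EE'|E'E] := Ftot _ _ EF E'F.
      exists E'; split=> // q; rewrite inE => /orP[/eqP->//|qs /(sE _ qs)].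
      exact: EE'.
    exists E; split=> // q; rewrite inE => /orP[/eqP-> _|qs /(sE _ qs)//].
    exact: E'E.
  apply: leq_trans (FP _ EF J) _; apply: fsubset_leq_card.
  apply/bigfcupsP => i iJ _; apply/fsubsetP => v /inS[vA nE].
  apply/bigfcupP; exists i; rewrite ?iJ //; apply/inS; split=> //.
  by move=> /(DE _ _ iJ vA).
have maxS i x : x \in sub D i -> ~ hall (drop_at (sub D) i x).
  move=> /inS[xA nD]; have := maxD (D `|` [set (i, x)])%classic.
  rewrite /proper /= => mx hd; apply: mx; first split.
  - by move=> ? ?; left.
  - by move=> /(_ (i, x)); apply: contra_not nD; apply; right.
  - suff <- : drop_at (sub D) i x = sub (D `|` [set (i, x)])%classic by [].
    apply/funext => j; apply/fsetP => v; rewrite /drop_at.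
    have [->|ji] := eqVneq j i.
      rewrite in_fsetD1; apply/andP/inS => [[vx /inS[vA nDv]]|[vA nDv]].
        by split=> // -[//|[]] /eqP; rewrite (negPf vx).
      split; first by apply/eqP => vx; apply: nDv; right; rewrite vx.
      by apply/inS; split=> // ?; apply: nDv; left.
    apply/inS/inS => -[vA nDv]; split=> //.
      by move=> [//|[] /eqP]; rewrite (negPf ji).
    by move=> ?; apply: nDv; left.
have uniqS i x y : x \in sub D i -> y \in sub D i -> x = y.
  move=> xS yS; apply/eqP/contraT => xy.
  by case: (hall_drop_at hD xy xS yS) => /maxS; case.
have exS i : exists v, v \in sub D i.
  have := hD [fset i]; rewrite cardfs1 big_seq_fset1 cardfs_gt0.
  by move=> /fset0Pn.
have [m mS] := choice exS.
exists m; split; last by move=> i; case/inS: (mS i).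
(* Two equal singletons would have a union of one element, against Hall's condition for the pair of
   indices. *)
move=> i j mij; apply/eqP/contraT => ij.
have := hD [fset i; j]; rewrite cardfs2 ij leqNgt => /negP[].
rewrite /= ltnS -(cardfs1 (m i)); apply: fsubset_leq_card.
apply/bigfcupsP => k; rewrite !inE => kij _; apply/fsubsetP => v vS.
rewrite inE; apply/eqP/(uniqS k) => //.
by case/orP: kij => /eqP->; rewrite ?mS // mij mS.
Qed.

End Hall.

(** * Finitely additive probability measures *)

Section FinAdd.
Local Open Scope classical_set_scope.
Local Open Scope ring_scope.
Variables (R : realType) (X : Type) (mu : set X -> R).
Hypothesis muP : finadd_probability mu.

Lemma finadd_set0 : mu set0 = 0.
Proof.
have := finadd_setU muP (set0I set0); rewrite setU0 => e.
by apply: (addrI (mu set0)); rewrite -e addr0.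
Qed.

Lemma finadd_subset A B : A `<=` B -> mu A <= mu B.
Proof.
move=> AB; have := finadd_setU muP (setDIK A B); rewrite setDUK // => ->.
by rewrite lerDl (finadd_ge0 muP).
Qed.

Lemma finadd_setC A : mu (~` A) = 1 - mu A.
Proof.
rewrite -(finadd_setT muP) -(setUv A) (finadd_setU muP) ?setICr //.
by rewrite addrC addKr.
Qed.

Lemma finadd_setU_le A B : mu (A `|` B) <= mu A + mu B.
Proof.
have -> : A `|` B = A `|` (B `\` A).
  by apply/seteqP; split=> x; have := EM (A x); rewrite /=; tauto.
by rewrite (finadd_setU muP) ?setDIK // lerD2l finadd_subset // => x [].
Qed.

Lemma bigcup_fin (K : finType) (L : K -> set X) :
  \bigcup_k L k = \big[setU/set0]_k L k.
Proof.
rewrite -[RHS]bigcup_seq; apply/seteqP; split=> x [k _ Lx]; exists k => //=.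
by rewrite mem_index_enum.
Qed.

Lemma finadd_bigcup_null (K : finType) (L : K -> set X) :
  (forall k, mu (L k) = 0) -> mu (\bigcup_k L k) = 0.
Proof.
move=> L0; rewrite bigcup_fin.
apply: (big_ind (fun A => mu A = 0)) => // [|A B A0 B0].
  exact: finadd_set0.
apply/eqP; rewrite eq_le (finadd_ge0 muP) andbT.
by apply: le_trans (finadd_setU_le _ _) _; rewrite A0 B0 addr0.
Qed.

Lemma finadd_bigcup (K : finType) (L : K -> set X) :
  (forall k l x, L k x -> L l x -> k = l) ->
  mu (\bigcup_k L k) = \sum_k mu (L k).
Proof.
move=> Ldisj; rewrite bigcup_fin.
have := index_enum_uniq K; elim: (index_enum K) => [|k s IHs] /=.
  by rewrite !big_nil finadd_set0.
case/andP=> ks us; rewrite !big_cons (finadd_setU muP) ?IHs //.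
rewrite -bigcup_seq -subset0 => x [Lkx [l /= ls Llx]].
by rewrite (Ldisj _ _ _ Lkx Llx) ls in ks.
Qed.

End FinAdd.

(** * Almost invariant finite sets avoiding a null set *)

Section Folner.
Local Open Scope nat_scope.
Variables (R : realType) (X : choiceType) (mu : set X -> R).
Hypothesis muP : finadd_probability mu.

(* A Hall matching from q + 1 copies of X \ B to q copies of X that moves
   points only by the [a t] would compress total mass q + 1 into q. *)
Lemma no_compression (T : finType) (a : T -> X -> X) (B : set X) (q : nat)
    (m : {x : X | ~~ `[< B x >]} * 'I_q.+1 -> X * 'I_q) :
  (forall t (L : set X), mu (a t @` L)%classic = mu L) -> mu B = 0%R ->
  injective m -> ~ (forall p, exists t, (m p).1 = a t (val p.1)).
Proof.
move=> mua muB minj /choice[tt ttP].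
(* [L i j t] gathers the points whose copy [i] is sent into copy [j] by [a t]. For fixed [i] these
   sets partition the complement of [B], of mass 1; for fixed [j] their images under the [a t] are
   disjoint, of total mass at most 1. *)
pose L (i : 'I_q.+1) (j : 'I_q) (t : T) : set X :=
  [set x | exists p, [/\ val p.1 = x, p.2 = i, tt p = t & (m p).2 = j]]%classic.
have sumL i : (\sum_j \sum_t mu (L i j t) = 1)%R.
  rewrite pair_bigA -(finadd_bigcup muP (L := fun p => L i p.1 p.2)).
    rewrite -[RHS]subr0 -muB -(finadd_setC muP).
    congr mu; apply/seteqP; split=> [x [_ _ [[[y By] j] [/= <- _ _ _]]]|x nBx].
      by apply/asboolPn.
    have Bx : ~~ `[< B x >] by apply/asboolPn.
    pose p := (Sub x Bx : {x : X | ~~ `[< B x >]}, i).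
    by exists ((m p).2, tt p) => //; exists p.
  move=> [j t] [j' t'] x /= [p [px pi <- <-]] [p' [p'x p'i <- <-]].
  suff -> : p = p' by [].
  case: p p' px pi p'x p'i => [y k] [y' k'] /= <- -> /val_inj-> ->//.
have sumJ j : (\sum_i \sum_t mu (L i j t) <= 1)%R.
  rewrite pair_bigA -(finadd_setT muP) /=.
  under eq_bigr => p _ do rewrite -(mua p.2).
  rewrite -(finadd_bigcup muP (L := fun p => a p.2 @` (L p.1 j p.2))%classic).
    exact: finadd_subset.
  move=> [i t] [i' t'] _ /= [_ [p [<- <- <- pj]] <-].
  move=> [_ [p' [<- <- <- p'j]]]; rewrite -!ttP => epp.
  suff -> : p = p' by [].
  apply: minj; move: epp pj p'j; case: (m p) (m p') => [? ?] [? ?] /=.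
  by move=> -> -> ->.
have : (\sum_(i < q.+1) (1 : R) <= \sum_(j < q) 1)%R.
  rewrite -(eq_bigr _ (fun i _ => sumL i)) exchange_big /=.
  by apply: ler_sum => j _; apply: sumJ.
by rewrite !sumr_const !card_ord ler_nat ltnn.
Qed.

Lemma folner (T : finType) (a : T -> X -> X) (B : set X) (q : nat) :
  (forall t (L : set X), mu (a t @` L)%classic = mu L) ->
  (forall t, injective (a t)) -> mu B = 0%R ->
  exists S : {fset X}, [/\ S != fset0,
    forall x, x \in S -> ~ B x &
    forall t, q * #|` [fset x in S | a t x \notin S]%fset| <= #|` S|].
Proof.
move=> mua ainj muB.
(* The identity is adjoined so that [N S] below contains [S]. *)
pose b (t : option T) := if t is Some t then a t else id.
have mub t (L : set X) : mu (b t @` L)%classic = mu L.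
  by case: t => [t|] /=; rewrite ?mua ?image_id.
pose N (S : {fset X}) : {fset X} :=
  [fset x in [seq b t x | t <- enum {: option T}, x <- enum_fset S]]%fset.
have inN S t x : x \in S -> b t x \in N S.
  move=> xS; rewrite inE /=; apply/allpairsPdep; exists t, x.
  by rewrite mem_enum; split.
have [[S [S0 SB leN]]|noS] := pselect (exists S : {fset X}, [/\ S != fset0,
    forall x, x \in S -> ~ B x & q * #|` N S| <= q.+1 * #|` S|]).
  exists S; split=> // t.
  (* The points of [E] leave [S], so their images add |E| new points: q (|S| + |E|) <= q |N S| <= (q
     + 1) |S|. *)
  rewrite -(leq_add2l (q * #|` S|)) -mulnDr -mulSnr (leq_trans _ leN) //.
  rewrite leq_mul2l; apply/orP; right.
  set E := [fset x in S | _]%fset.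
  have <- : #|` [fset a t x | x in E]%fset| = #|` E|.
    by apply/eqP/card_in_imfsetP => x y _ _; apply: ainj.
  have /eqP <- : #|` S `|` [fset a t x | x in E]|%fset
      == #|` S| + #|` [fset a t x | x in E]|%fset.
    rewrite leq_card_fsetU; apply/fdisjointP => x xS; apply/negP.
    case/imfsetP => y /=; rewrite !inE => /andP[_ /negP ayS] xy.
    by rewrite -xy in ayS.
  apply: fsubset_leq_card; apply/fsubUsetP; split; apply/fsubsetP => x.
    exact: (inN S None).
  case/imfsetP => y /=; rewrite !inE => /andP[yS _ ->].
  by have := inN S (Some t) y yS; rewrite !inE.
exfalso.
pose Y := {x : X | ~~ `[< B x >]}.
(* Each of the q + 1 copies of a point [x] off [B] is joined to all q copies of the points of N {x}.
   A finite [J] with projection [S] has at most (q + 1) |S| elements, and its neighbourhood consists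
   of the q copies of [N S]. *)
pose A (p : Y * 'I_q.+1) : {fset X * 'I_q} :=
  [fset u in [seq (x, j) | x <- enum_fset (N [fset val p.1]%fset),
                           j <- enum 'I_q]]%fset.
have inA p u : (u \in A p) = (u.1 \in N [fset val p.1]%fset).
  rewrite inE /=; apply/allpairsPdep/idP => [[x [j [xN _ ->]]] //|uN].
  by exists u.1, u.2; rewrite mem_enum; split=> //; case: u uN.
have hA : hall A.
  move=> J; pose S := [fset val p.1 | p in J]%fset.
  have SB x : x \in S -> ~ B x.
    by move=> /imfsetP[[[y By] i] /= _ ->]; apply/asboolPn.
  apply: (@leq_trans (q.+1 * #|` S|)).
    pose s := [seq (x, j) | x <- enum_fset S, j <- enum 'I_q.+1].
    have <- : size s = q.+1 * #|` S|.
      by rewrite size_allpairs size_enum_ord mulnC.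
    rewrite -(size_map (fun p => (val p.1, p.2))); apply: uniq_leq_size.
      by rewrite map_inj_uniq ?fset_uniq // => -[y i] [y' i'] [] /val_inj-> ->.
    move=> _ /mapP[p pJ ->]; apply/allpairsPdep; exists (val p.1), p.2.
    by rewrite mem_enum; split=> //; apply/imfsetP; exists p.
  have [->|S0] := eqVneq S fset0; first by rewrite cardfs0 muln0.
  have : q.+1 * #|` S| <= q * #|` N S|.
    by rewrite leqNgt; apply/negP => /ltnW leN; apply: noS; exists S.
  move=> /leq_trans; apply.
  pose s := [seq (x, j) | x <- enum_fset (N S), j <- enum 'I_q].
  have <- : size s = q * #|` N S| by rewrite size_allpairs size_enum_ord mulnC.
  apply: uniq_leq_size.
    by apply: allpairs_uniq; rewrite ?enum_uniq ?fset_uniq // => -[? ?] [? ?].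
  move=> u /allpairsPdep[x [j [xN _ ->]]]; move: xN.
  rewrite inE /= => /allpairsPdep[t [x' [_ x'S ->]]].
  move: x'S => /imfsetP[p /= pJ ->].
  apply/bigfcupP; exists p; rewrite ?pJ // inA inN //=; exact: fset11.
have [m [minj mA]] := hall_matching hA.
apply: (no_compression mub muB minj) => p.
have := mA p; rewrite inA inE /= => /allpairsPdep[t [x [_ ]]].
by move=> /fset1P-> ->; exists t.
Qed.

End Folner.

(** * Permutations extending partial injections *)

Lemma perm_extend (T : finType) (D : {set T}) (f : T -> T) :
  {in D &, injective f} -> exists s : {perm T}, {in D, s =1 f}.
Proof.
move=> finj; pose C := ~: D; pose E := ~: (f @: D).
have cCE : size (enum C) = size (enum E).
  rewrite -[LHS]cardE -[RHS]cardE [LHS]cardsCs [RHS]cardsCs.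
  by rewrite !finset.setCK card_in_imset.
(* [D] and its image have complements of equal size; the k-th element of one goes to the k-th of the
   other. The default [x] of [nth] is never reached. *)
pose h x := if x \in D then f x else nth x (enum E) (index x (enum C)).
have idxC x : x \notin D -> (index x (enum C) < size (enum E))%N.
  by move=> xD; rewrite -cCE index_mem mem_enum inE.
have hE x : x \notin D -> h x \in E.
  by move=> xD; rewrite /h (negPf xD) -mem_enum mem_nth ?idxC.
have hf x : x \in D -> h x \notin E.
  by move=> xD; rewrite inE negbK /h xD imset_f.
have hinj : injective h.
  move=> x y; have [xD|xD] := boolP (x \in D); have [yD|yD] := boolP (y \in D).
  - by rewrite /h xD yD; apply: finj.
  - by move=> e; have := hE _ yD; rewrite -e (negPf (hf _ xD)).
  - by move=> e; have := hE _ xD; rewrite e (negPf (hf _ yD)).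
  rewrite /h (negPf xD) (negPf yD) (set_nth_default y x) ?idxC // => /eqP.
  rewrite nth_uniq ?enum_uniq ?idxC // => /eqP.
  by move/(congr1 (nth x (enum C))); rewrite !nth_index ?mem_enum ?inE.
by exists (perm hinj) => x xD; rewrite permE /h xD.
Qed.

Section AlmostPerm.
Local Open Scope nat_scope.

(** [v] enumerates an almost invariant set off [B]; [s t] can disagree with [a t] only at points
    that [a t] moves out of this set. *)
Lemma finadd_almost_perm (R : realType) (X : choiceType) (mu : set X -> R)
    (T : finType) (a : T -> X -> X) (B : set X) (q : nat) :
  finadd_probability mu ->
  (forall t (L : set X), mu (a t @` L)%classic = mu L) ->
  (forall t, injective (a t)) -> mu B = 0%R ->
  exists n (v : 'I_n -> X) (s : T -> 'S_n), [/\ 0 < n, injective v,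
    forall i, ~ B (v i) &
    forall t, q * #|[set i | v (s t i) != a t (v i)]| <= n].
Proof.
move=> muP mua ainj muB.
have [S [S0 SB leS]] := folner muP q mua ainj muB.
pose n := #|` S|; pose v (i : 'I_n) : X := tnth (in_tuple (enum_fset S)) i.
have vS i : v i \in S by apply: mem_tnth.
have vinj : injective v by apply/tuple_uniqP; exact: fset_uniq.
have vonto x : x \in S -> exists i, v i = x.
  by move=> /(tnthP (in_tuple _))[i ->]; exists i.
suff /choice[s sP] t : exists s : 'S_n,
    q * #|[set i | v (s i) != a t (v i)]| <= n.
  by exists n, v, s; split=> //; [rewrite /n cardfs_gt0|move=> i; exact: SB].
(* [f] follows [a t] where it stays in [S]; elsewhere its value is arbitrary. *)
have /choice[f fP] (i : 'I_n) : exists j, a t (v i) \in S -> v j = a t (v i).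
  by have [/vonto[j jE]|] := boolP (a t (v i) \in S); [exists j|exists i].
pose D := [set i | a t (v i) \in S].
have finj : {in D &, injective f}.
  move=> i j; rewrite !inE => /fP vi /fP vj e.
  by apply/vinj/(ainj t); rewrite -vi e.
have [s sD] := perm_extend finj.
exists s; apply: leq_trans (leS t); rewrite leq_mul2l; apply/orP; right.
have -> : #|[set i | v (s i) != a t (v i)]|
    = size [seq v i | i <- enum [set i | v (s i) != a t (v i)]].
  by rewrite size_map cardE.
apply: uniq_leq_size; first by rewrite map_inj_uniq ?enum_uniq.
move=> _ /mapP[i + ->]; rewrite mem_enum inE => vi; rewrite !inE vS /=.
apply: contraNN vi => atS; apply/eqP; rewrite sD ?inE //; exact: fP.
Qed.
End AlmostPerm.

(** * From an almost-action to soficity *)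

Section ActionToSofic.
Local Open Scope ring_scope.

Lemma leq_sub_nb_fix n (s : 'S_n) : (n <= nb_fix s + #|[set i | s i != i]|)%N.
Proof.
rewrite /nb_fix -[X in (X <= _)%N]card_ord -(cardsC [set i | s i == i]).
rewrite leq_add2l subset_leq_card //.
by apply/fintype.subsetP => i; rewrite !inE.
Qed.

Lemma almost_action_sofic (R : realType) (Gamma : groupType) (X : choiceType)
    (mu : set X -> R) (phi : Gamma -> X -> X) :
  amenable_almost_action mu phi -> essentially_free mu phi -> sofic R Gamma.
Proof.
move=> [muP bij phi1 inv almM] free eps F /andP[eps0 eps1] finF.
have /choice[A AP] (p : Gamma * Gamma) : exists A : set X, mu A = 1 /\
    forall x, A x -> phi (p.1 * p.2)%g x = phi p.1 (phi p.2 x).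
  exact: almM.
pose E0 := fset_set F.
have inE0 e : F e -> e \in E0 by move=> Fe; rewrite in_fset_set // inE.
(* Products are included because each relation compares the permutations at [e], [f] and [e * f]. *)
pose E : {fset Gamma} := [fset g in enum_fset E0 ++
  [seq (e * f)%g | e <- enum_fset E0, f <- enum_fset E0]]%fset.
(* [C] contains all failures of multiplicativity on [F], and [D] consists of the fixed points of its
   nontrivial elements. *)
pose C : set X :=
  (\bigcup_(p : E0 * E0) ~` A (val p.1, val p.2))%classic.
pose D : set X :=
  (\bigcup_(e : E0) [set x | val e <> 1%g /\ phi (val e) x = x])%classic.
have muC : mu C = 0.
  apply: finadd_bigcup_null => // p.
  by rewrite (finadd_setC muP) (AP _).1 subrr.
have muD : mu D = 0.
  apply: finadd_bigcup_null => // e; apply/eqP.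
  rewrite eq_le (finadd_ge0 muP) andbT.
  have [e1|/eqP e1] := eqVneq (val e) 1%g.
    by rewrite -(finadd_set0 muP); apply: finadd_subset => // x [].
  by rewrite -(free _ e1); apply: finadd_subset => // x [].
have muB : mu (C `|` D)%classic = 0.
  apply/eqP; rewrite eq_le (finadd_ge0 muP) andbT.
  by apply: le_trans (finadd_setU_le muP _ _) _; rewrite muC muD addr0.
(* Three permutations enter a relation, each wrong at no more than n / q points; hence 3 / eps. *)
pose q := Num.bound (3 / eps).
have q3 : 3 <= eps * q%:R.
  have : 3 / eps < q%:R by apply: archi_boundP; rewrite divr_ge0 // ltW.
  by rewrite ltr_pdivrMr // mulrC => /ltW.
have q0 : 0 < q%:R :> R.
  by rewrite ltr0n lt0n; apply: contraTneq q3 => ->; rewrite mulr0 -ltNge.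
have [n [v [s [n0 vinj vB sP]]]] := @finadd_almost_perm R X mu E
  (fun t => phi (val t)) (C `|` D)%classic q muP (fun t => inv (val t))
  (fun t => bij_inj (bij (val t))) muB.
(* The value at 1 is imposed, since [s] only approximates the identity there; outside [E] the value
   is arbitrary. *)
pose sigma g : 'S_n :=
  if g == 1%g then 1%g else if insub g is Some t then s t else 1%g.
pose bad g := [set i | v (sigma g i) != phi g (v i)].
have badP g : g \in E -> (q * #|bad g| <= n)%N.
  move=> gE; have [g1|gn1] := eqVneq g 1%g.
    rewrite (_ : bad g = finset.set0) ?cards0 ?muln0 //.
    by apply/setP => i; rewrite !inE g1 /sigma eqxx perm1 phi1 eqxx.
  by have := sP [` gE]%fset; rewrite /bad /sigma (negPf gn1) insubT.
have E0E e : e \in E0 -> e \in E.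
  by move=> eE; rewrite /E in_fset /= mem_cat; apply/orP; left.
exists n, sigma; split=> //.
- move=> e f Fe Ff.
  set w := (_ * _ * _)%g; set m := #|[set i | w i != i]|.
  have leqm : (q * m <= 3 * n)%N.
    apply: (@leq_trans (q * (#|bad (e * f)%g| + #|bad f| + #|bad e|))).
      rewrite leq_mul2l; apply/orP; right.
      (* Preimages under permutations keep cardinalities: moved points are counted through
         [sigma (e * f)], which cancels the inverse that opens [w], and [bad e] is tested at
         [sigma f i], where [sigma e] is applied. *)
      rewrite -[#|bad e|](card_preimset _ (@perm_inj _ (sigma f))).
      have efinj := @perm_inj _ (sigma (e * f)%g).
      rewrite /m -[X in (X <= _)%N](card_preimset _ efinj).
      apply: (@leq_trans #|bad (e * f)%g :|: bad f :|: (sigma f @^-1: bad e)|).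
        apply: subset_leq_card; apply/fintype.subsetP => i.
        rewrite 2!inE /w !permM permK; apply: contraTT.
        rewrite !inE !negb_or !negbK.
        move=> /andP[/andP[/eqP vef /eqP vf] /eqP ve].
        apply/eqP/vinj; rewrite ve vf vef (AP (e, f)).2 //=.
        apply: contrapT => nA; case: (vB i); left.
        by exists ([` inE0 _ Fe]%fset, [` inE0 _ Ff]%fset).
      by rewrite !(leq_trans (leq_card_setU _ _)) // leq_add2r leq_card_setU.
    rewrite !mulnDr; have efE : (e * f)%g \in E.
      rewrite /E in_fset /= mem_cat; apply/orP; right.
      by apply/allpairsP; exists (e, f); split; rewrite ?inE0.
    have := badP _ efE; have := badP _ (E0E _ (inE0 _ Fe)).
    have := badP _ (E0E _ (inE0 _ Ff)); lia.
  have := leq_sub_nb_fix w; rewrite -(ler_nat R) natrD -/m => nfix.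
  have qm : q%:R * m%:R <= 3 * n%:R :> R by rewrite -!natrM ler_nat.
  have qn : 3 * n%:R <= eps * q%:R * n%:R :> R by rewrite ler_wpM2r.
  have : q%:R * (m%:R - eps * n%:R) <= (0 : R) by lra.
  by rewrite pmulr_rle0 // => mn; lra.
- by rewrite /sigma eqxx.
move=> e Fe e1.
have := badP _ (E0E _ (inE0 _ Fe)).
(* Off [D], [phi e] moves [v i], so every [i] fixed by [sigma e] is bad. *)
have : (nb_fix (sigma e) <= #|bad e|)%N.
  apply: subset_leq_card; apply/fintype.subsetP => i; rewrite !inE => /eqP ->.
  apply/eqP => vi; case: (vB i); right.
  by exists [` inE0 _ Fe]%fset.
set m := nb_fix _; move=> le1 le2.
have qm : q%:R * m%:R <= n%:R :> R.
  by rewrite -natrM ler_nat (leq_trans _ le2) // leq_mul2l le1 orbT.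
rewrite -subr_le0.
have qn : 3 * n%:R <= eps * q%:R * n%:R :> R by rewrite ler_wpM2r.
have n0' : 0 <= n%:R :> R by [].
have : q%:R * (m%:R - eps * n%:R) <= (0 : R) by lra.
by rewrite pmulr_rle0.
Qed.
End ActionToSofic.

(** * Limits of bounded families along an ultrafilter *)

Section Ultralimit.
Local Open Scope classical_set_scope.
Local Open Scope ring_scope.

Lemma fmap_ultra (S T : Type) (f : S -> T) (U : set_system S) :
  UltraFilter U -> UltraFilter (f @ U).
Proof.
move=> uU; split; first exact: fmap_proper_filter.
move=> G pG UG; apply/seteqP; split=> // A GA; rewrite /fmap /=.
have [//|nA] := in_ultra_setVsetC (f @^-1` A) uU.
have /UG GnA : (f @ U) (~` A) by [].
by have /filter_ex[x []] : G (A `&` ~` A) by exact: filterI.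
Qed.

(** The family pushes [U] to an ultrafilter on the compact interval [0, 1]. *)
Lemma ultra_bounded_cvg (R : realType) (I : Type) (U : set_system I)
    (u : I -> R) :
  UltraFilter U -> (forall i, 0 <= u i <= 1) -> cvg (u @ U).
Proof.
move=> uU u01.
have := @segment_compact R 0 1.
rewrite compact_ultra => /(_ _ (fmap_ultra u uU))[].
  by apply: (@filterE _ U _ (u @^-1` _)) => i /=; rewrite in_itv /=.
move=> l [_ ul].
by apply/cvg_ex; exists l.
Qed.

End Ultralimit.

(** * Ultralimit of normalized counting measures *)

Section SoficToAction.
Local Open Scope classical_set_scope.
Local Open Scope ring_scope.
Variables (R : realType) (Gamma : groupType).

(** The pair (k, E) will index a sofic approximation for the finite set E with tolerance 1 / (k +
    2). *)
Let index := (nat * {fset Gamma})%type.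

(** An ultrafilter containing these tails makes the tolerance tend to 0 and the finite set absorb
    every element of [Gamma]. *)
Definition above (p : index) : set index :=
  [set r | (p.1 <= r.1)%N /\ (p.2 `<=` r.2)%fset].

Lemma above_proper : ProperFilter (filter_from setT above).
Proof.
apply: filter_from_proper; last by move=> p _; exists p; split.
apply: filter_fromT_filter; first by exists (0%N, fset0).
move=> p r; exists (maxn p.1 r.1, p.2 `|` r.2)%fset => x [].
by rewrite /= geq_max fsubUset => /andP[? ?] /andP[? ?]; split; split.
Qed.

Variables (n : index -> nat) (phi : forall p, Gamma -> 'S_(n p)).
Arguments phi : clear implicits.

Let X := {p : index & 'I_(n p)}.

Definition sofic_act (g : Gamma) (x : X) : X :=
  Tagged (fun p => 'I_(n p)) (phi (tag x) g (tagged x)).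

Definition density (A : set X) (p : index) : R :=
  #|[set i : 'I_(n p) | `[< A (Tagged (fun p => 'I_(n p)) i) >]]%SET|%:R
  / (n p)%:R.

Hypothesis n_gt0 : forall p, (0 < n p)%N.

Lemma density_bounds A p : 0 <= density A p <= 1.
Proof.
rewrite /density divr_ge0 //= ler_pdivrMr ?ltr0n // mul1r ler_nat.
by rewrite -[X in (_ <= X)%N]card_ord max_card.
Qed.

(** Each fibre is permuted, so invariance is exact at every index, before the limit. *)
Lemma density_act g A p : density (sofic_act g @` A) p = density A p.
Proof.
congr (_%:R / _); rewrite -[RHS](card_imset _ (@perm_inj _ (phi p g))).
apply: eq_card => i; rewrite inE; apply/asboolP/imsetP.
  move=> [[r j] Arj /[dup]/(congr1 tag)/= rp]; subst r => /eqP.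
  rewrite eq_Tagged /= => /eqP <-; exists j => //.
  by rewrite inE; apply/asboolP.
move=> [j + ->]; rewrite inE => /asboolP Aj.
by exists (Tagged (fun p => 'I_(n p)) j).
Qed.

Lemma density_setU A B p : A `&` B = set0 ->
  density (A `|` B) p = density A p + density B p.
Proof.
move=> AB; rewrite /density -mulrDl -natrD; congr (_%:R / _).
rewrite -cardsUI [X in (_ = _ + X)%N]eq_card0 ?addn0 => [|i].
  by apply: eq_card => i; rewrite !inE asbool_or.
rewrite !inE -asbool_and; apply/asboolPn => ABi.
by have : set0 (Tagged (fun p => 'I_(n p)) i) by rewrite -AB.
Qed.

Lemma density_setT p : density setT p = 1.
Proof.
rewrite /density (_ : finset.finset _ = [set: 'I_(n p)]%SET).
  by rewrite cardsT card_ord divff // pnatr_eq0 -lt0n.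
by apply/setP => i; rewrite !inE; apply/asboolP.
Qed.

Variable U : set_system index.
Hypotheses (uU : UltraFilter U) (aboveU : filter_from setT above `<=` U).

Definition ultra_density (A : set X) : R := lim (density A @ U).

Lemma density_cvg A : density A @ U --> ultra_density A.
Proof. exact: (ultra_bounded_cvg uU (density_bounds A)). Qed.

Lemma ultra_density_prob : finadd_probability ultra_density.
Proof.
split=> [A||A B AB].
- apply: limr_ge; first exact: density_cvg.
  by apply: filterE => p; case/andP: (density_bounds A p).
- rewrite /ultra_density (_ : density setT = cst 1) ?lim_cst //.
  by apply/funext => p; exact: density_setT.
rewrite /ultra_density (_ : density _ = density A \+ density B).
  by rewrite limD //; exact: density_cvg.
by apply/funext => p; exact: density_setU.
Qed.

(** [U] contains the tail above (k, E) for some k > 1 / e, and on it the error is below e. *)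
Lemma ultra_density_eq A (E : {fset Gamma}) (c : R) :
  (forall p, (E `<=` p.2)%fset -> `|c - density A p| <= p.1.+2%:R^-1) ->
  ultra_density A = c.
Proof.
move=> Ac; apply: cvg_lim => //; apply/cvgrPdist_le => e e0.
have : U (above (Num.bound e^-1, E)).
  by apply: aboveU; exists (Num.bound e^-1, E).
apply: filterS => p [/= le_p Ep]; apply: le_trans (Ac p Ep) _.
have bound_lt : e^-1 < (Num.bound e^-1)%:R.
  by rewrite archi_boundP // invr_ge0 ltW.
rewrite invf_ple ?posrE //; apply: ltW (lt_le_trans bound_lt _).
by rewrite ler_nat; do 2!apply: leqW.
Qed.

End SoficToAction.

(** * From soficity to an almost-action *)

Section Ultraproduct.
Local Open Scope classical_set_scope.
Local Open Scope ring_scope.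

Lemma sofic_almost_action (R : realType) (Gamma : groupType) :
  sofic R Gamma ->
  exists (X : Type) (mu : set X -> R) (phi : Gamma -> X -> X),
    amenable_almost_action mu phi /\ essentially_free mu phi.
Proof.
move=> sof.
have /choice[n nP] (p : nat * {fset Gamma}) :
    exists n (phi : Gamma -> 'S_n), [/\ (0 < n)%N,
      forall g h, g \in p.2 -> h \in p.2 -> (1 - p.1.+2%:R^-1) * n%:R <=
        (nb_fix ((phi (g * h)%g)^-1 * phi h * phi g)%g)%:R :> R,
      phi 1%g = 1%g &
      forall g, g \in p.2 -> g <> 1%g ->
        (nb_fix (phi g))%:R <= p.1.+2%:R^-1 * n%:R :> R].
  apply: (sof _ [set` p.2] _ (finite_fset p.2)).
  (* The shift by 2 keeps the tolerance strictly below 1 even for k = 0. *)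
  by rewrite invr_gt0 ltr0n /= invf_lt1 ?ltr0n // ltr1n.
have [phi phiP] := all_sig (fun p => cid (nP p)).
have n_gt0 p : (0 < n p)%N by case: (phiP p).
have [U [uU aboveU]] := ultraFilterLemma (above_proper Gamma).
exists {p : nat * {fset Gamma} & 'I_(n p)}, (ultra_density R U).
exists (sofic_act phi).
split; first split.
- exact: ultra_density_prob.
- move=> g; pose inv (x : {p & 'I_(n p)}) := ((phi (tag x) g)^-1 (tagged x))%g.
  exists (fun x => Tagged (fun p => 'I_(n p)) (inv x)) => -[p i].
    by rewrite /inv /sofic_act /= permK.
  by rewrite /inv /sofic_act /= permKV.
- move=> [p i]; rewrite /sofic_act /=.
  by case: (phiP p) => _ _ -> _; rewrite perm1.
- move=> g L; rewrite /ultra_density; congr (lim (_ @ U)).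
  by apply/funext => p; exact: density_act.
- move=> g h.
  (* The witness is the whole set where the relation holds; its density is at least 1 - 1 / (k + 2)
     once the index contains [g] and [h]. *)
  exists [set x | sofic_act phi (g * h)%g x
                = sofic_act phi g (sofic_act phi h x)].
  split=> //; apply: (ultra_density_eq uU aboveU (E := [fset g; h]%fset)) => p.
  rewrite fsubUset !fsub1set => /andP[gp hp].
  have [_ /(_ g h gp hp) fixgh _ _] := phiP p.
  set A := (X in density R X p).
  have /andP[_ dA1] := density_bounds R n_gt0 A p.
  rewrite ger0_norm ?subr_ge0 // lerBlDr -lerBlDl.
  rewrite /density ler_pdivlMr ?ltr0n //.
  apply: le_trans fixgh _; rewrite ler_nat /nb_fix.
  (* Counting through [phi p (g * h)] cancels the inverse that is applied first. *)
  rewrite -(card_preimset _ (@perm_inj _ (phi p (g * h)%g))).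
  apply: subset_leq_card; apply/fintype.subsetP => i.
  rewrite !inE !permM permK => /eqP e.
  by rewrite /A /sofic_act /= e.
move=> g g1; apply: (ultra_density_eq uU aboveU (E := [fset g]%fset)) => p.
rewrite fsub1set => gp; have [_ _ _ /(_ g gp g1) fixg] := phiP p.
set A := (X in density R X p).
have /andP[dA0 _] := density_bounds R n_gt0 A p.
rewrite sub0r normrN ger0_norm // /density ler_pdivrMr ?ltr0n //.
apply: le_trans fixg; rewrite ler_nat /nb_fix.
apply: subset_leq_card; apply/fintype.subsetP => i.
rewrite !inE /A /sofic_act /= => /eqP.
by rewrite eq_Tagged.
Qed.
End Ultraproduct.

Theorem corollary4p2 (R : realType) (Gamma : groupType) :
  (exists (X : Type) (mu : set X -> R) (phi : Gamma -> X -> X),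
     amenable_almost_action mu phi /\ essentially_free mu phi)
  <-> sofic R Gamma.
Proof.
split; last exact: sofic_almost_action.
(* [{classic X}] gives the arbitrary type [X] the choice structure that finite sets over it
   require. *)
by move=> [X [mu [phi []]]]; exact: (@almost_action_sofic R Gamma {classic X}).
Qed.
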